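(* Let $P$ be the transition matrix of a finite irreducible Markov chain with states $\{1,\dots,m\}$, stationary probabilities $\{\pi_j\}$ and mean first passage times $\{m_{ij}\}$. Let $G=[g_{ij}]=G(\boldsymbol{\alpha},\boldsymbol{\beta},\gamma)$ be any g-inverse of $I-P$, with $\boldsymbol{\alpha}^T=(\alpha_1,\dots,\alpha_m)$ and $\boldsymbol{\beta}^T=(\beta_1,\dots,\beta_m)$, and let $\delta_j=\sum_{k\neq j}\beta_k m_{kj}$ for $j=1,\dots,m$. Then for all $i,j\in\{1,\dots,m\}$, $$g_{ij}=\begin{cases}\left(1+\gamma+\delta_j-m_{ij}+\sum_{k\neq i}\pi_k\alpha_k m_{ik}-\sum_{k=1}^m\pi_k\alpha_k\delta_k\right)\pi_j, & i\neq j,\\[4pt] \left(1+\gamma+\delta_j+\sum_{k\neq j}\pi_k\alpha_k m_{jk}-\sum_{k=1}^m\pi_k\alpha_k\delta_k\right)\pi_j, & i=j.\end{cases}$$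
   Context: The Markov chain $\{X_n\}_{n\ge 0}$ is discrete-time with state space $\{1,\dots,m\}$. $\boldsymbol{e}$ is the all-ones column vector; $\boldsymbol{\pi}^T=(\pi_1,\dots,\pi_m)$ is the unique stationary probability vector ($\boldsymbol{\pi}^TP=\boldsymbol{\pi}^T$, $\boldsymbol{\pi}^T\boldsymbol{e}=1$). $m_{ij}=E[T_{ij}\mid X_0=i]$, where $T_{ij}=\min\{n\ge 1: X_n=j\}$ given $X_0=i$ (first return when $i=j$); these are finite and $m_{jj}=1/\pi_j$. A g-inverse of $I-P$ is a real $m\times m$ matrix $G$ with $(I-P)G(I-P)=I-P$. Parametric form (known fact): every g-inverse $G$ of $I-P$ can be uniquely written as $G=[I-P+\boldsymbol{\alpha}\boldsymbol{\beta}^T]^{-1}+\gamma\boldsymbol{e}\boldsymbol{\pi}^T$ with $\boldsymbol{\alpha},\boldsymbol{\beta}\in\mathbb{R}^m$, $\gamma\in\mathbb{R}$, $\boldsymbol{\pi}^T\boldsymbol{\alpha}=1$, $\boldsymbol{\beta}^T\boldsymbol{e}=1$; this is written $G=G(\boldsymbol{\alpha},\boldsymbol{\beta},\gamma)$. *)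

(* Defs.v *)
From HB Require Import structures.
From mathcomp Require Import all_boot all_order all_algebra.
From mathcomp Require Import all_classical all_reals all_analysis.

Set Implicit Arguments.
Unset Strict Implicit.
Unset Printing Implicit Defensive.

Import Order.TTheory GRing.Theory Num.Theory.
Import numFieldNormedType.Exports.

Local Open Scope classical_set_scope.
Local Open Scope ring_scope.

(* The states 1, ..., m are encoded as the elements of 'I_m. *)

Definition ones (R : realType) (m : nat) : 'cV[R]_m := const_mx 1.

Definition stochastic (R : realType) (m : nat) (P : 'M[R]_m) : Prop :=
  (forall i j, 0 <= P i j) /\ P *m ones R m = ones R m.

Definition irreducible_chain (R : realType) (m : nat) (P : 'M[R]_m) : Prop :=
  forall i j, exists n : nat, 0 < (P ^+ n) i j.

Definition stationary (R : realType) (m : nat) (P : 'M[R]_m) (pi : 'rV[R]_m)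
  : Prop :=
  [/\ forall j, 0 <= pi 0 j, pi *m P = pi & pi *m ones R m = 1%:M].

Definition cond_prob (d : measure_display) (T : measurableType d)
  (R : realType) (Pr : probability T R) (A B : set T) : R :=
  fine (Pr (A `&` B)) / fine (Pr B).

(* Time-homogeneous Markov chain: conditionally on any trajectory
   x_0, ..., x_n of positive probability, X_{n+1} has law (P x_n j)_j.
   The initial law is left free. *)
Definition markov_chain (d : measure_display) (T : measurableType d)
  (R : realType) (Pr : probability T R) (m : nat) (X : nat -> T -> 'I_m)
  (P : 'M[R]_m) : Prop :=
  (forall n j, measurable [set w | X n w = j]) /\
  (forall (n : nat) (x : nat -> 'I_m) (j : 'I_m),
     let past := [set w | forall k : nat, (k <= n)%N -> X k w = x k] in
     (0 < Pr past)%E ->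
     cond_prob Pr [set w | X n.+1 w = j] past = P (x n) j).

(* T_j = min {n >= 1 : X_n = j}; it is +oo on trajectories which never
   visit j at a positive time, since the infimum of set0 is +oo. *)
Definition passage_time (T : Type) (R : realType) (m : nat)
  (X : nat -> T -> 'I_m) (j : 'I_m) (w : T) : \bar R :=
  ereal_inf [set (n%:R)%:E | n in [set n : nat | (0 < n)%N /\ X n w = j]].

(* m_ij = E[T_j | X_0 = i], where Pr i is the law of the chain started at i.
   The integral is taken in \bar R; [fine] only reads it back as a real
   number, the expectation being finite for an irreducible finite chain. *)
Definition mean_passage_time (d : measure_display) (T : measurableType d)
  (R : realType) (m : nat) (Pr : 'I_m -> probability T R)
  (X : nat -> T -> 'I_m) (i j : 'I_m) : R :=
  fine (\int[Pr i]_w passage_time R X j w)%E.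

Definition ginverse (R : realType) (m : nat) (A G : 'M[R]_m) : Prop :=
  A *m G *m A = A.

(* The matrix G(alpha, beta, gamma). The inverted matrix is nonsingular when
   P is irreducible stochastic and pi alpha = beta^T e = 1, so the default
   value of [invmx] on singular matrices plays no role. *)
Definition ginv_param (R : realType) (m : nat) (P : 'M[R]_m) (pi : 'rV[R]_m)
  (alpha beta : 'cV[R]_m) (gamma : R) : 'M[R]_m :=
  invmx (1%:M - P + alpha *m beta^T) + gamma *: (ones R m *m pi).

(* Main.v *)
(* The series sum_n Pr_i(T_j > n) converges and the first-step equations
   m_ij = 1 + sum_(k != j) P_ik m_kj follow by taking limits in its partial
   sums. Averaging them against pi gives pi_j m_jj = 1. With D the off-diagonal
   part of (m_ij), Pi = diag(pi), e = ones, they read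
   (I - P) D Pi = e pi - I, so that, with eta = beta^T D Pi,
     H = e pi + e eta - D Pi + D Pi alpha pi - (eta alpha) e pi
   satisfies (I - P) H = I - alpha pi and beta^T H = pi; hence H is the inverse
   of I - P + alpha beta^T, and its entries give the formula. *)

Require Import Defs.
From HB Require Import structures.
From mathcomp Require Import all_boot all_order all_algebra.
From mathcomp Require Import all_classical all_reals all_analysis.
From mathcomp Require Import measurable_realfun ring.

Set Implicit Arguments.
Unset Strict Implicit.
Unset Printing Implicit Defensive.

Import Order.TTheory GRing.Theory Num.Theory.
Import numFieldNormedType.Exports.

Local Open Scope classical_set_scope.
Local Open Scope ring_scope.

(** * Irreducibility and positivity of the stationary vector *)

Lemma stationaryE (R : realType) (m : nat) (P : 'M[R]_m) (pi : 'rV[R]_m) l :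
  stationary P pi -> \sum_k pi 0 k * P k l = pi 0 l.
Proof. by move=> [_ /matrixP/(_ 0 l) + _]; rewrite mxE. Qed.

Lemma stationary_sum (R : realType) (m : nat) (P : 'M[R]_m) (pi : 'rV[R]_m) :
  stationary P pi -> \sum_k pi 0 k = 1.
Proof.
move=> [_ _ /matrixP/(_ 0 0)]; rewrite !mxE eqxx mulr1n => <-.
by apply: eq_bigr => k _; rewrite mxE mulr1.
Qed.

Lemma sumr_gt0_exists (R : realDomainType) (I : finType) (F : I -> R) :
  0 < \sum_i F i -> exists i, 0 < F i.
Proof.
move=> F0; apply: contrapT => nF; move: F0; apply/negP; rewrite -leNgt.
apply: sumr_le0 => i _; rewrite leNgt; apply/negP => Fi.
by apply: nF; exists i.
Qed.

(** A positive entry [(P ^+ n.+1) j i] has a positive term [(P ^+ n) j k * P k i], so induction on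
    the path length carries [A] from [j] to [i]. Used to propagate positivity of [pi] and
    boundedness of the survival series. *)
Lemma irreducible_step_closed (R : realType) (m : nat) (P : 'M[R]_m)
    (A : 'I_m -> Prop) (j : 'I_m) :
  stochastic P -> irreducible_chain P ->
  (forall k l, A k -> 0 < P k l -> A l) -> A j -> forall i, A i.
Proof.
move=> [P0 _] irrP step Aj i; have [n] := irrP j i.
elim: n i => [|n IHn] i.
  by rewrite expr0 mxE; case: eqP => [<-//|_]; rewrite mulr0n ltxx.
rewrite exprSr mxE => /sumr_gt0_exists[k Pk].
have Pki : 0 < P k i.
  rewrite lt_neqAle P0 andbT eq_sym; apply: contraTneq Pk => ->.
  by rewrite mulr0 ltxx.
by apply: (step k) => //; apply: IHn; rewrite -(pmulr_lgt0 _ Pki).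
Qed.

(** Some [pi 0 k] is positive because the sum is 1, and stationarity gives
    [pi 0 l >= pi 0 k * P k l]. *)
Lemma stationary_gt0 (R : realType) (m : nat) (P : 'M[R]_m) (pi : 'rV[R]_m) :
  stochastic P -> irreducible_chain P -> stationary P pi ->
  forall j, 0 < pi 0 j.
Proof.
move=> hP irrP hpi; have [pi0 _ _] := hpi; have [P0 _] := hP.
have [k pik] : exists k, 0 < pi 0 k.
  by apply: sumr_gt0_exists; rewrite (stationary_sum hpi).
apply: (irreducible_step_closed hP irrP _ pik) => {pik}k l pik Pkl.
rewrite -(stationaryE l hpi) (bigD1 k)//=.
by rewrite ltr_wpDr ?mulr_gt0// sumr_ge0// => q _; rewrite mulr_ge0.
Qed.

(** * The survival series and its first-step equations *)

(* survival P j n i is the probability that the chain started at i avoids j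
   at times 1, ..., n. *)
Fixpoint survival (R : realType) (m : nat) (P : 'M[R]_m) (j : 'I_m) (n : nat)
    (i : 'I_m) : R :=
  if n is n'.+1 then \sum_(l < m | l != j) P i l * survival P j n' l else 1.

Lemma survival_ge0 (R : realType) (m : nat) (P : 'M[R]_m) j n i :
  stochastic P -> 0 <= survival P j n i.
Proof.
move=> [P0 _]; elim: n i => [|n IHn] i /=; first exact: ler01.
by apply: sumr_ge0 => l _; rewrite mulr_ge0.
Qed.

Lemma series_survivalS (R : realType) (m : nat) (P : 'M[R]_m) j n i :
  series (fun k => survival P j k i) n.+1 =
  1 + \sum_(l < m | l != j) P i l * series (fun k => survival P j k l) n.
Proof.
rewrite /series /= big_nat_recl//=; congr (_ + _).
rewrite exchange_big/=; apply: eq_bigr => l _.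
by rewrite mulr_sumr.
Qed.

Lemma nondecreasing_series_survival (R : realType) (m : nat) (P : 'M[R]_m) j i :
  stochastic P -> nondecreasing_seq (series (fun k => survival P j k i)).
Proof.
move=> hP; apply/nondecreasing_seqP => n.
by rewrite seriesSr lerDl survival_ge0.
Qed.

(* Averaging S_(n+1) = 1 + Q S_n against pi, where Q is P with column j
   removed, bounds pi_j S_n(j) by 1; boundedness then propagates along the
   transitions of positive probability. *)
Lemma series_survival_bounded (R : realType) (m : nat) (P : 'M[R]_m)
    (pi : 'rV[R]_m) j :
  stochastic P -> irreducible_chain P -> stationary P pi ->
  forall i, exists B, forall n, series (fun k => survival P j k i) n <= B.
Proof.
move=> hP irrP hpi; have [P0 _] := hP; have [pi0 _ _] := hpi.
set S := fun i => series (fun k => survival P j k i).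
have S0 i n : 0 <= S i n by apply: sumr_ge0 => k _; exact: survival_ge0.
have SS i n : S i n <= S i n.+1.
  by apply: nondecreasing_series_survival.
have Sj n : S j n <= (pi 0 j)^-1.
  rewrite -[leRHS]mul1r ler_pdivlMr ?(stationary_gt0 hP irrP hpi)// mulrC.
  have : \sum_i pi 0 i * S i n <= \sum_i pi 0 i * S i n.+1.
    by apply: ler_sum => i _; rewrite ler_wpM2l.
  under [leRHS]eq_bigr => i _ do
    rewrite /S series_survivalS mulrDr mulr1 mulr_sumr.
  rewrite big_split/= (stationary_sum hpi) exchange_big/=.
  rewrite [X in _ <= _ + X](eq_bigr (fun l => pi 0 l * S l n)) => [|l _].
    by rewrite (bigD1 j)//= lerD2r.
  by under eq_bigr do rewrite mulrA; rewrite -mulr_suml (stationaryE _ hpi).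
apply: (@irreducible_step_closed _ _ P _ j hP irrP) => [k l [B SB] Pkl|];
  last by exists (pi 0 j)^-1.
(* The recursion omits column [j], so the case [l = j] rests on [Sj] instead. *)
have [->|lj] := eqVneq l j; first by exists (pi 0 j)^-1.
(* Keeping only the term [l] of the recursion, [P k l * S l n <= S k n.+1 <= B]. *)
exists (B / P k l) => n; rewrite ler_pdivlMr// mulrC.
apply: le_trans (SB n.+1); rewrite /S series_survivalS (bigD1 l)//=.
rewrite addrCA lerDl addr_ge0// sumr_ge0// => q _.
by rewrite mulr_ge0//; exact: S0.
Qed.

Lemma is_cvg_series_survival (R : realType) (m : nat) (P : 'M[R]_m)
    (pi : 'rV[R]_m) j i :
  stochastic P -> irreducible_chain P -> stationary P pi ->
  cvgn (series (fun k => survival P j k i)).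
Proof.
move=> hP irrP hpi; have [B SB] := series_survival_bounded j hP irrP hpi i.
apply: nondecreasing_is_cvgn; first exact: nondecreasing_series_survival.
by exists B => _ [n _ <-].
Qed.

Lemma lim_series_survival (R : realType) (m : nat) (P : 'M[R]_m)
    (pi : 'rV[R]_m) j i :
  stochastic P -> irreducible_chain P -> stationary P pi ->
  let h l := limn (series (fun k => survival P j k l)) in
  h i = 1 + \sum_(l < m | l != j) P i l * h l.
Proof.
move=> hP irrP hpi h.
have hl l := is_cvg_series_survival (j := j) (i := l) hP irrP hpi.
apply: cvg_lim => //; rewrite -cvg_shiftS /=.
under eq_fun do rewrite series_survivalS.
apply: cvgD; first exact: cvg_cst.
apply: cvg_big => [|l _]; first exact: add_continuous.
by apply: cvgM; [exact: cvg_cst|exact: hl].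
Qed.

(** * Laws of trajectories and of passage times *)

Definition past (T : Type) (m : nat) (X : nat -> T -> 'I_m) (n : nat)
    (x : nat -> 'I_m) : set T :=
  [set w | forall k : nat, (k <= n)%N -> X k w = x k].

(** For [n = 0] this is the event T_j > r. The window starts at an arbitrary [n] because the
    induction on its length moves the start to [n.+1]. *)
Definition avoids (T : Type) (m : nat) (X : nat -> T -> 'I_m) (j : 'I_m)
    (n r : nat) : set T :=
  [set w | forall k : nat, (n < k <= n + r)%N -> X k w != j].

Lemma measurable_past (d : measure_display) (T : measurableType d) (m : nat)
    (X : nat -> T -> 'I_m) n x :
  (forall k l, measurable [set w | X k w = l]) -> measurable (past X n x).
Proof.
move=> mX.
rewrite (_ : past X n x = \bigcap_(k in `I_n.+1) [set w | X k w = x k]) //.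
by apply: bigcap_measurableType => k _; exact: mX.
Qed.

Lemma measurable_avoids (d : measure_display) (T : measurableType d) (m : nat)
    (X : nat -> T -> 'I_m) j n r :
  (forall k l, measurable [set w | X k w = l]) -> measurable (avoids X j n r).
Proof.
move=> mX.
rewrite (_ : avoids X j n r =
    \bigcap_(k in [set k | (n < k <= n + r)%N]) ~` [set w | X k w = j]).
  by apply: bigcap_measurableType => k _; apply: measurableC; exact: mX.
by apply/seteqP; split=> w aw k kr; apply/eqP; exact: aw.
Qed.

Section passage_probability.
Local Open Scope ereal_scope.

Lemma measure_pastS (d : measure_display) (T : measurableType d)
    (R : realType) (Pr : probability T R) (m : nat) (X : nat -> T -> 'I_m)
    (P : 'M[R]_m) n x :
  markov_chain Pr X P ->
  Pr (past X n.+1 x) = Pr (past X n x) * (P (x n) (x n.+1))%:E.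
Proof.
move=> [mX markov]; have mpast k := measurable_past k x mX.
have pastS : past X n.+1 x = [set w | X n.+1 w = x n.+1] `&` past X n x.
  apply/seteqP; split=> [w Xw|w [Xn Xw] k].
    by split=> [|k kn]; apply: Xw => //; exact: leqW.
  by rewrite leq_eqVlt ltnS => /predU1P[->//|]; exact: Xw.
(* The Markov property is assumed only for pasts of positive probability; for a null past both sides
   are 0. *)
have [past0|past_gt0] := eqVneq (Pr (past X n x)) 0.
  rewrite past0 mul0e; apply/eqP; rewrite eq_le measure_ge0 andbT -past0.
  by apply: le_measure; rewrite ?inE// pastS; exact: subIsetr.
have := markov n x (x n.+1) _; rewrite /cond_prob -pastS => <-; last first.
  by rewrite lt0e past_gt0 measure_ge0.
rewrite -/(past X n x) -[X in X * _]fineK ?fin_num_measure// -EFinM.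
rewrite mulrC divfK ?fineK ?fin_num_measure//.
by rewrite fine_eq0// fin_num_measure.
Qed.

(** Induction on [r] with [n] and [x] general: splitting by the value [l != j] of [X n.+1] leaves
    pasts up to time [n.+1] followed by windows of length [r]. *)
Lemma measure_past_avoids (d : measure_display) (T : measurableType d)
    (R : realType) (Pr : probability T R) (m : nat) (X : nat -> T -> 'I_m)
    (P : 'M[R]_m) j n r x :
  stochastic P -> markov_chain Pr X P ->
  Pr (past X n x `&` avoids X j n r) =
  Pr (past X n x) * (survival P j r (x n))%:E.
Proof.
move=> hP markovX; have [mX _] := markovX.
elim: r n x => [|r IHr] n x /=.
  rewrite mule1; congr (Pr _); apply/setIidl => w _ k.
  by rewrite addn0 => /andP[/leq_trans/[apply]]; rewrite ltnn.
(* Only the values of [x] up to time [n] matter, so [x] may be overwritten at time [n.+1] by the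
   state reached there. *)
pose y l k := if k == n.+1 then l else x k.
have yn l : y l n = x n by rewrite /y ltn_eqF.
have pasty l : past X n (y l) = past X n x.
  apply/seteqP; split=> w Xw k kn; have := Xw k kn;
    by rewrite /y ltn_eqF// ltnS.
pose F l := past X n.+1 (y l) `&` avoids X j n.+1 r.
have PrF l : Pr (F l) = Pr (past X n x) * (P (x n) l * survival P j r l)%:E.
  rewrite /F IHr (measure_pastS _ _ markovX) pasty yn /y eqxx.
  by rewrite -muleA -EFinM.
have -> : past X n x `&` avoids X j n r.+1 =
    \big[setU/set0]_(l < m | l != j) F l.
  rewrite -(bigcup_pred (fun l => l != j)).
  apply/seteqP; split=> w.
    move=> [Xw aw]; exists (X n.+1 w).
      by apply: aw; rewrite ltnSn addnS ltnS leq_addr.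
    split=> k kn; rewrite /y.
      by case: eqP => [->//|/eqP kn1]; apply: Xw; rewrite -ltnS ltn_neqAle kn1.
    by apply: aw; move: kn => /andP[nk kn]; rewrite (ltnW nk) addnS -addSn.
  move=> [l lj [Xw aw]]; split=> [k kn|k /andP[nk kn]].
    by have := Xw k (leqW kn); rewrite /y ltn_eqF// ltnS.
  have [->|kn1] := eqVneq k n.+1; first by rewrite (Xw n.+1)// /y eqxx.
  by apply: aw; rewrite ltn_neqAle eq_sym kn1 nk addSn -addnS.
rewrite measure_bigsetU_ord_cond; last 2 first.
- by move=> l _; apply: measurableI;
    [exact: measurable_past|exact: measurable_avoids].
- move=> l q _ _ [w [[pl _] [pq _]]].
  by have := pl n.+1 (leqnn _); rewrite (pq n.+1 (leqnn _)) /y eqxx.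
rewrite (eq_bigr (fun l =>
  Pr (past X n x) * (P (x n) l * survival P j r l)%:E)).
  rewrite -ge0_sume_distrr ?sumEFin// => l _.
  by rewrite lee_fin mulr_ge0 ?survival_ge0// hP.1.
by move=> l _; exact: PrF.
Qed.

Lemma probability_setI1 (d : measure_display) (T : measurableType d)
    (R : realType) (Pr : probability T R) (A B : set T) :
  measurable A -> measurable B -> Pr A = 1 -> Pr (A `&` B) = Pr B.
Proof.
move=> mA mB PA; have mAB := measurableI _ _ mA mB.
apply/eqP; rewrite eq_le; apply/andP; split.
  by apply: le_measure; rewrite ?inE//; exact: subIsetr.
(* The part of [B] outside [A] lies in the complement of [A], which is null. *)
rewrite [leLHS](measureDI _ mB mA) setIC -[leRHS]add0e leeD2r//.
rewrite -(subee (x := 1)) // -[X in _ <= _ - X]PA -probability_setC//.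
apply: le_measure; rewrite ?inE; [exact: measurableD|exact: measurableC|].
exact: subDsetr.
Qed.

(** The term of index [n] is the indicator of T_j > n, so this is the tail-sum formula; both sides
    are infinite if [j] is never visited. *)
Lemma passage_timeE (T : Type) (R : realType) (m : nat)
    (X : nat -> T -> 'I_m) (j : 'I_m) w :
  passage_time R X j w = \sum_(n <oo) (\1_(avoids X j 0 n) w)%:E.
Proof.
have ind0 n : (0%R : \bar R) <= (\1_(avoids X j 0 n) w)%:E by rewrite lee_fin.
have [hit|nohit] := pselect (exists n, (0 < n)%N && (X n w == j)).
  set N := ex_minn hit.
  have [N0 XN minN] : [/\ (0 < N)%N, X N w = j &
      forall k, (0 < k)%N -> X k w = j -> (N <= k)%N].
    rewrite /N; case: ex_minnP => n /andP[n0 /eqP Xn] minn; split=> // k k0 Xk.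
    by apply: minn; rewrite k0 Xk eqxx.
  transitivity (N%:R%:E : \bar R).
    apply/eqP; rewrite eq_le; apply/andP; split.
      by apply: ereal_inf_lbound; exists N.
    apply: le_ereal_inf_tmp => _ [n [n0 Xn] <-].
    by rewrite lee_fin ler_nat minN.
  (* Avoiding [j] at times 1, ..., n means n < N, so exactly the [N] terms of index 0, ..., N - 1
     equal 1. *)
  rewrite (nneseries_split 0 N)// add0n.
  rewrite [X in _ + X]eseries0 ?adde0 => [|n Nn _].
    rewrite sumEFin; congr EFin.
    rewrite (eq_big_nat _ _ (F2 := fun=> 1%R)) => [|n /andP[_ nN]].
      by rewrite sumr_const_nat subn0.
    rewrite indicE mem_set// => k; rewrite add0n => /andP[k0 kn].
    by apply/eqP => /(minN _ k0); rewrite leqNgt (leq_ltn_trans kn nN).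
  rewrite indicE memNset// => /(_ N).
  by rewrite N0 add0n Nn XN eqxx => /(_ isT).
rewrite /passage_time (_ : [set n | _] = set0); last first.
  rewrite -subset0 => n [n0 Xn]; apply: nohit; exists n.
  by rewrite n0 Xn eqxx.
rewrite image_set0 ereal_inf0; apply/esym.
rewrite (eq_eseriesr (g := fun=> 1)) => [|n _].
  apply: cvg_lim => //; under eq_fun do rewrite sumEFin sumr_const_nat subn0.
  exact/cvgenyP/cvg_id.
rewrite indicE mem_set// => k /andP[k0 _]; apply/eqP => Xk.
by apply: nohit; exists k; rewrite k0 Xk eqxx.
Qed.

(** The tail-sum formula is integrated term by term, all terms being nonnegative; convergence makes
    the extended limit finite, so [fine] returns it unchanged. *)
Lemma mean_passage_timeE (d : measure_display) (T : measurableType d)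
    (R : realType) (m : nat) (Pr : 'I_m -> probability T R)
    (X : nat -> T -> 'I_m) (P : 'M[R]_m) i j :
  stochastic P -> markov_chain (Pr i) X P -> Pr i [set w | X 0%N w = i] = 1 ->
  cvgn (series (fun k => survival P j k i)) ->
  mean_passage_time Pr X i j = limn (series (fun k => survival P j k i)).
Proof.
move=> hP markovX X0 cvgS; have [mX _] := markovX.
have mA n := measurable_avoids j 0 n mX.
rewrite /mean_passage_time.
under eq_integral do rewrite passage_timeE.
rewrite integral_nneseries//; last first.
  by move=> n; apply/measurable_EFinP; exact: measurable_indic.
(* The starting event is a past up to time 0, which lets [measure_past_avoids] apply. *)
have past0 : past X 0 (fun=> i) = [set w | X 0%N w = i].
  by apply/seteqP; split=> [w Xw|w Xw k]; [exact: Xw|rewrite leqn0 => /eqP->].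
rewrite (eq_eseriesr (g := fun n => (survival P j n i)%:E)) => [|n _].
  rewrite (_ : (fun n => _) = EFin \o series (fun k => survival P j k i)).
    by rewrite EFin_lim.
  by apply/funext => n /=; rewrite sumEFin.
transitivity (Pr i (avoids X j 0 n)); first by rewrite integral_indic// setIT.
rewrite -(probability_setI1 (mX 0%N i) _ X0)//.
by rewrite -past0 (measure_past_avoids _ _ _ _ hP markovX) past0 X0 mul1e.
Qed.

End passage_probability.

(** * Linear algebra of the parametric g-inverse *)

(** Probability enters only through the first-step equations for [M]; the [if] covers both cases of
    the formula at once. *)
Lemma ginv_param_passage (R : realType) (m : nat) (P : 'M[R]_m)
    (M : 'I_m -> 'I_m -> R) (pi : 'rV[R]_m) (alpha beta : 'cV[R]_m)
    (gamma : R) (i j : 'I_m) :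
  stochastic P -> stationary P pi ->
  (forall k l, M k l = 1 + \sum_(q < m | q != l) P k q * M q l) ->
  pi *m alpha = 1%:M -> beta^T *m ones R m = 1%:M ->
  let delta l := \sum_(k < m | k != l) beta k 0 * M k l in
  ginv_param P pi alpha beta gamma i j =
  (1 + gamma + delta j - (if i == j then 0 else M i j)
   + \sum_(k < m | k != i) pi 0 k * alpha k 0 * M i k
   - \sum_(k < m) pi 0 k * alpha k 0 * delta k) * pi 0 j.
Proof.
move=> hP hpi hM halpha hbeta delta.
have [_ P1] := hP.
pose D : 'M[R]_m := \matrix_(k, l) if k == l then 0 else M k l.
have sumD (F : 'I_m -> R) l :
    \sum_k F k * D k l = \sum_(k < m | k != l) F k * M k l.
  rewrite [RHS]big_mkcond/=; apply: eq_bigr => k _; rewrite mxE.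
  by case: eqP => //=; rewrite mulr0.
have piM l : pi 0 l * M l l = 1.
  have : \sum_k pi 0 k * (M k l - \sum_q P k q * D q l) = 1.
    rewrite -(stationary_sum hpi); apply: eq_bigr => k _.
    by rewrite sumD hM addrK mulr1.
  under eq_bigr do rewrite mulrBr mulr_sumr.
  rewrite sumrB exchange_big/=.
  rewrite [X in _ - X](eq_bigr (fun q => pi 0 q * D q l)) => [|q _]; last first.
    by under eq_bigr do rewrite mulrA; rewrite -mulr_suml (stationaryE _ hpi).
  by rewrite sumD (bigD1 l)//= addrK.
(* Off the diagonal the first-step equation leaves 1; on it, [D] drops [M l l], leaving
   [1 - M l l]. *)
have IPD k l : ((1%:M - P) *m D) k l = 1 - (k == l)%:R * M l l.
  rewrite mulmxBl mul1mx mxE [X in _ + X]mxE [(P *m D) _ _]mxE sumD [D _ _]mxE.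
  by have [->|kl] := eqVneq k l; rewrite hM /=; ring.
pose N := D *m diag_mx pi.
have NE k l : N k l = (if k == l then 0 else M k l) * pi 0 l.
  by rewrite /N mul_mx_diag !mxE.
have IPN : (1%:M - P) *m N = ones R m *m pi - 1%:M.
  rewrite /N mulmxA; apply/matrixP => k l.
  rewrite mul_mx_diag mxE IPD !mxE big_ord1 !mxE mul1r mulrBl mul1r mulrAC.
  by rewrite -mulrA piM mulr1.
pose eta := beta^T *m N.
have etaE l : eta 0 l = delta l * pi 0 l.
  rewrite /eta /N mulmxA mul_mx_diag !mxE; congr (_ * _).
  by under eq_bigr do rewrite mxE; rewrite sumD.
have bN : beta^T *m N = eta by [].
(* From here [N] and [eta] are atoms, known only through [NE], [IPN], [etaE] and [bN]. *)
clearbody eta N.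
pose H := ones R m *m pi + ones R m *m eta - N + N *m alpha *m pi
   - (eta *m alpha) 0 0 *: (ones R m *m pi).
have IP1 : (1%:M - P) *m ones R m = 0 by rewrite mulmxBl mul1mx P1 subrr.
have IPH : (1%:M - P) *m H = 1%:M - alpha *m pi.
  rewrite /H mulmxBr !mulmxDr mulmxN -scalemxAr !mulmxA IP1 IPN !mul0mx.
  rewrite scaler0 !add0r subr0 mulmxBl -mulmxA halpha mulmx1 mulmxBl mul1mx.
  by rewrite opprB addrA subrK.
have bH : beta^T *m H = pi.
  rewrite /H mulmxBr !mulmxDr mulmxN -scalemxAr !mulmxA hbeta !mul1mx bN.
  by rewrite addrK [X in X *m pi]mx11_scalar mul_scalar_mx addrK.
have AH : (1%:M - P + alpha *m beta^T) *m H = 1%:M.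
  by rewrite mulmxDl IPH -mulmxA bH subrK.
have -> : ginv_param P pi alpha beta gamma = H + gamma *: (ones R m *m pi).
  rewrite /ginv_param; congr (_ + _).
  (* A right inverse of a square matrix is two-sided, so [invmx] is a genuine inverse here and
     equals [H]. *)
  have [uA _] := mulmx1_unit AH.
  by rewrite -[RHS](mulKmx uA) AH mulmx1.
have etaalpha : (eta *m alpha) 0 0 = \sum_(k < m) pi 0 k * alpha k 0 * delta k.
  by rewrite mxE; apply: eq_bigr => k _; rewrite etaE; ring.
(* The factor [pi 0 k] is the column scaling in [N], and the zero diagonal of [D] removes
   [k = i]. *)
have Nalpha : \sum_k N i k * alpha k 0 =
    \sum_(k < m | k != i) pi 0 k * alpha k 0 * M i k.
  rewrite [RHS]big_mkcond/=; apply: eq_bigr => k _; rewrite NE eq_sym.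
  by case: eqP => _ /=; ring.
by rewrite /H etaalpha !mxE !big_ord1 !mxE Nalpha NE etaE; ring.
Qed.

Theorem theorem11 (R : realType) (m : nat) (P : 'M[R]_m) (pi : 'rV[R]_m)
  (d : measure_display) (T : measurableType d)
  (Pr : 'I_m -> probability T R) (X : nat -> T -> 'I_m)
  (G : 'M[R]_m) (alpha beta : 'cV[R]_m) (gamma : R)
  (hP : stochastic P)
  (hirr : irreducible_chain P)
  (hpi : stationary P pi)
  (hX : forall i : 'I_m, markov_chain (Pr i) X P)
  (hX0 : forall i : 'I_m, Pr i [set w | X 0%N w = i] = 1%E)
  (hG : ginverse (1%:M - P) G)
  (halpha : pi *m alpha = 1%:M)
  (hbeta : beta^T *m ones R m = 1%:M)
  (hGparam : G = ginv_param P pi alpha beta gamma) :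
  let mfp := mean_passage_time Pr X in
  let delta (j : 'I_m) : R := \sum_(k < m | k != j) beta k 0 * mfp k j in
  forall i j : 'I_m,
    (i != j ->
     G i j = (1 + gamma + delta j - mfp i j
              + \sum_(k < m | k != i) pi 0 k * alpha k 0 * mfp i k
              - \sum_(k < m) pi 0 k * alpha k 0 * delta k) * pi 0 j)
    /\
    (i = j ->
     G i j = (1 + gamma + delta j
              + \sum_(k < m | k != j) pi 0 k * alpha k 0 * mfp j k
              - \sum_(k < m) pi 0 k * alpha k 0 * delta k) * pi 0 j).
Proof.
move=> mfp delta i j.
have mfpE k l : mfp k l = limn (series (fun n => survival P l n k)).
  by apply: mean_passage_timeE => //; exact: is_cvg_series_survival hpi.
have hmfp k l : mfp k l = 1 + \sum_(q < m | q != l) P k q * mfp q l.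
  rewrite mfpE (lim_series_survival l k hP hirr hpi).
  by congr (_ + _); apply: eq_bigr => q _; rewrite mfpE.
rewrite hGparam (ginv_param_passage _ _ _ hP hpi hmfp halpha hbeta).
by split=> [/negbTE ->//|->]; rewrite eqxx subr0.
Qed.
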